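(* Let $n\ge 1$, let $d \ge 1$ be a natural number and let $(v,w)\in\mathcal{T}_n$ be a pair of permutations. Then the number of standard monomials for the Richardson variety $X_w^v$ in degree $d$ (that is, the number of semi-standard Young tableaux $T=[I_1\dots I_d]$ with $d$ columns satisfying $w_d^-(T)\le w$ and $v\le w_1^+(T)$) is equal to $|SSYT_d(v,w)|$.
   Context: **Orders.** $[n]=\{1,\dots,n\}$; $w\in S_n$ is written $w=(w_1,\dots,w_n)$ with $w_i=w(i)$. For subsets of $[n]$: $\{i_1<\dots<i_s\}\le\{j_1<\dots<j_t\}$ if $s\ge t$ and $i_1\le j_1,\dots,i_t\le j_t$. Bruhat order on $S_n$: $v\le w$ if $\{v_1,\dots,v_k\}\le\{w_1,\dots,w_k\}$ for all $k\in[n]$. For a subset $I$ with $|I|=k$: $I\le w$ means $I\le\{w_1,\dots,w_k\}$, and $v\le I$ means $\{v_1,\dots,v_k\}\le I$. **Compatible pairs and $\mathcal{T}_n$.** For $w\in S_n$ ($n\ge2$) with $w_t=n$, the induced permutation is $\underline w=(w_1,\dots,w_{t-1},w_{t+1},\dots,w_n)\in S_{n-1}$. Let $v,w\in S_n$ with $n=v_t=w_{t'}$ and $n-1=v_s=w_{s'}$. The pair $(v,w)$ is compatible if either (i) $t=t'$, or (ii) $t'<t$ and $s'\le t$, $t'\le s$, $n=w_{t'}>w_{t'+1}>\dots>w_t$ and $n=v_t>v_{t-1}>\dots>v_{t'}$. Define $\mathcal{T}_1=\{(\mathrm{id},\mathrm{id})\}$ and $\mathcal{T}_{n+1}=\{(v,w)\in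 S_{n+1}\times S_{n+1}:(\underline v,\underline w)\in\mathcal{T}_n\text{ and }(v,w)\text{ is compatible}\}$. **Tableaux.** A semi-standard Young tableau $T=[I_1\dots I_d]$ is a sequence of non-empty proper subsets of $[n]$ (its columns) with $I_1\le\dots\le I_d$. $SSYT_d(v,w)$ is the set of semi-standard Young tableaux $T=[I_1\dots I_d]$ with $v\le I_k\le w$ for all $k\in[d]$. **Defining chains.** A defining chain for $T=[I_1\dots I_d]$ is a sequence $(\mathbf u_1,\dots,\mathbf u_d)$ of permutations in $S_n$ with $\mathbf u_1\le\dots\le\mathbf u_d$ in Bruhat order such that $I_k=\{\mathbf u_k(1),\dots,\mathbf u_k(|I_k|)\}$ for each $k$. Defining chains of $T$ are compared componentwise. It is known that $T$ has a unique minimum defining chain $(w_1^-(T),\dots,w_d^-(T))$ and a unique maximum defining chain $(w_1^+(T),\dots,w_d^+(T))$. **Standard monomials.** The tableau $[I_1\dots I_d]$ is identified with the monomial $P_{I_1}\cdots P_{I_d}$ in Plücker variables. $T$ is called standard for $X_w^v$ if $w_d^-(T)\le w$ and $v\le w_1^+(T)$; it is known (Lakshmibai–Littelmann) that these monomials form a basis of the homogeneous coordinate ring of the Richardson variety $X_w^v=X_w\cap X^v$ in the full flag variety. *)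

(* Defs.v *)
From mathcomp Require Import all_boot all_fingroup.

Set Implicit Arguments.
Unset Strict Implicit.
Unset Printing Implicit Defensive.

(* Positions and values are shifted down by one: [n] = {1, ..., n} is          *)
(* represented by 'I_n = {0, ..., n-1}, and w_i by the value of w at i - 1.    *)

Section Orders.
Variable n : nat.
Implicit Types (I J : {set 'I_n}) (v w : 'S_n).

Definition elements I : seq nat := [seq val i | i <- enum I].

Lemma size_elements I : size (elements I) = #|I|.
Proof. by rewrite size_map -cardE. Qed.

Lemma elements_sorted I : sorted ltn (elements I).
Proof.
rewrite /elements /enum_mem -enumT; apply: (@subseq_sorted _ ltn ltn_trans).
  by apply: map_subseq; apply: filter_subseq.
by rewrite val_enum_ord iota_ltn_sorted.
Qed.

Definition subset_le I J : bool :=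
  (#|J| <= #|I|) &&
  [forall k : 'I_#|J|, nth 0 (elements I) k <= nth 0 (elements J) k].

(* {w_1, ..., w_k} *)
Definition initial w (k : nat) : {set 'I_n} := [set w i | i : 'I_n & i < k].

Definition bruhat_le v w : bool :=
  [forall k : 'I_n, subset_le (initial v k.+1) (initial w k.+1)].

Definition subset_le_perm I w : bool := subset_le I (initial w #|I|).
Definition perm_le_subset v I : bool := subset_le (initial v #|I|) I.

Lemma subset_le_anti I J : subset_le I J -> subset_le J I -> I = J.
Proof.
move=> /andP[JI /forallP leIJ] /andP[IJ /forallP leJI].
have eqIJ : #|I| = #|J| by apply/eqP; rewrite eqn_leq IJ JI.
have E : elements I = elements J.
  apply: (@eq_from_nth _ 0) => [|k]; rewrite !size_elements // => ltk.
  have ltkJ : k < #|J| by rewrite -eqIJ.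
  apply/eqP; rewrite eqn_leq (leIJ (Ordinal ltkJ)).
  exact: (leJI (Ordinal ltk)).
apply/setP=> x; rewrite -[x \in I]mem_enum -[x \in J]mem_enum.
by rewrite (inj_map val_inj E).
Qed.

Lemma mem_initial w k i : (w i \in initial w k) = (i < k).
Proof. by rewrite /initial mem_imset ?inE //; apply: perm_inj. Qed.

Lemma bruhat_le_anti v w : bruhat_le v w -> bruhat_le w v -> v = w.
Proof.
move=> /forallP vw /forallP wv.
have E k : k <= n -> initial v k = initial w k.
  case: k => [_|k ltk].
    by apply/setP=> x; apply/imsetP/imsetP => -[i]; rewrite inE.
  by apply: subset_le_anti; [apply: (vw (Ordinal ltk))|apply: (wv (Ordinal ltk))].
apply/permP=> i; rewrite -[v i](permKV w); congr (w _); apply/val_inj/eqP.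
set j := (w^-1)%g (v i).
have Ej : w j = v i by rewrite permKV.
have ji : j < i.+1.
  by rewrite -(mem_initial w) Ej -(E i.+1) ?mem_initial ?ltn_ord.
have : ~~ (j < i).
  by rewrite -(mem_initial w) Ej -(E i) ?mem_initial ?ltnn // ltnW.
by rewrite -leqNgt => ij; rewrite eqn_leq ij andbT.
Qed.

End Orders.

Lemma induced_subproof n (w : 'S_n.+1) :
  injective (fun k : 'I_n =>
    odflt k (unlift ord_max (w (lift ((w^-1)%g ord_max) k)))).
Proof.
have H (k : 'I_n) : {j | w (lift ((w^-1)%g ord_max) k) = lift ord_max j
  & unlift ord_max (w (lift ((w^-1)%g ord_max) k)) = Some j}.
  apply: unlift_some; apply/eqP=> /(congr1 (w^-1)%g).
  by rewrite permK => E; move: (neq_lift ((w^-1)%g ord_max) k); rewrite {1}E eqxx.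
move=> k l /=; case: (H k) => i Ei ->; case: (H l) => j Ej -> /= eij.
by move: Ei; rewrite eij -Ej => /perm_inj /lift_inj.
Qed.

(* Deletes the largest value from the one-line notation of w; the default of   *)
(* odflt is never reached, see induced_lift.                                   *)
Definition induced n (w : 'S_n.+1) : 'S_n := perm (@induced_subproof n w).

Lemma induced_lift n (w : 'S_n.+1) :
  lift_perm ((w^-1)%g ord_max) ord_max (induced w) = w.
Proof.
apply/permP=> i; case: (unliftP ((w^-1)%g ord_max) i) => [k|] ->.
  rewrite lift_perm_lift permE.
  case: unliftP => [j -> //|/(congr1 (w^-1)%g)]; rewrite permK => E.
  by move: (neq_lift ((w^-1)%g ord_max) k); rewrite {1}E eqxx.
by rewrite lift_perm_id permKV.
Qed.

(* For S_(n+2): the largest value n + 2 is ord_max, and the value n + 1 is     *)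
(* inord n.                                                                    *)
Definition compatible n (v w : 'S_n.+2) : bool :=
  let t  := (v^-1)%g ord_max in
  let t' := (w^-1)%g ord_max in
  let s  := (v^-1)%g (inord n) in
  let s' := (w^-1)%g (inord n) in
  (t == t') ||
  [&& t' < t, s' <= t, t' <= s,
      [forall i : 'I_n.+2, forall j : 'I_n.+2,
         [&& t' <= i, i < j & j <= t] ==> (w j < w i)] &
      [forall i : 'I_n.+2, forall j : 'I_n.+2,
         [&& t' <= i, i < j & j <= t] ==> (v i < v j)]].

(* Membership in T_(m+1). *)
Fixpoint in_T_succ (m : nat) : 'S_m.+1 -> 'S_m.+1 -> bool :=
  match m with
  | 0 => fun v w => (v == 1%g) && (w == 1%g)
  | k.+1 => fun v w =>
      @in_T_succ k (induced v) (induced w) && compatible v w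
  end.

(* Membership in T_n, for n >= 1; the value at n = 0 is a dummy. *)
Definition in_T (n : nat) : 'S_n -> 'S_n -> bool :=
  match n with
  | 0 => fun _ _ => false
  | m.+1 => @in_T_succ m
  end.

Section Tableaux.
Variables n d : nat.
Implicit Types (T : d.-tuple {set 'I_n}) (u : d.-tuple 'S_n) (v w : 'S_n).

Definition is_ssyt T : bool :=
  all (fun I : {set 'I_n} => (I != set0) && (I != [set: 'I_n])) T &&
  sorted (@subset_le n) T.

Definition SSYT v w : {set d.-tuple {set 'I_n}} :=
  [set T | is_ssyt T &
     all (fun I => perm_le_subset v I && subset_le_perm I w) T].

Definition defining_chain T u : bool :=
  sorted (@bruhat_le n) u &&
  [forall k : 'I_d, tnth T k == initial (tnth u k) #|tnth T k|].

Definition chain_le u1 u2 : bool :=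
  [forall k : 'I_d, bruhat_le (tnth u1 k) (tnth u2 k)].

Definition min_defining_chain T u : bool :=
  defining_chain T u &&
  [forall u', defining_chain T u' ==> chain_le u u'].

Definition max_defining_chain T u : bool :=
  defining_chain T u &&
  [forall u', defining_chain T u' ==> chain_le u' u].

Lemma chain_le_anti u1 u2 : chain_le u1 u2 -> chain_le u2 u1 -> u1 = u2.
Proof.
move=> /forallP le12 /forallP le21; apply: eq_from_tnth => k.
exact: bruhat_le_anti.
Qed.

Lemma min_defining_chain_unique T u1 u2 :
  min_defining_chain T u1 -> min_defining_chain T u2 -> u1 = u2.
Proof.
move=> /andP[c1 /forallP m1] /andP[c2 /forallP m2].
by apply: chain_le_anti; [apply: (implyP (m1 u2))|apply: (implyP (m2 u1))].
Qed.

Lemma max_defining_chain_unique T u1 u2 :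
  max_defining_chain T u1 -> max_defining_chain T u2 -> u1 = u2.
Proof.
move=> /andP[c1 /forallP m1] /andP[c2 /forallP m2].
by apply: chain_le_anti; [apply: (implyP (m2 u1))|apply: (implyP (m1 u2))].
Qed.

(* w_d^-(T) <= w and v <= w_1^+(T). For d >= 1, last and head return the last  *)
(* and first entries of the chain, never the default 1.                        *)
Definition standard v w T : bool :=
  [exists u, min_defining_chain T u && bruhat_le (last 1%g u) w] &&
  [exists u, max_defining_chain T u && bruhat_le v (head 1%g u)].

Definition standard_tableaux v w : {set d.-tuple {set 'I_n}} :=
  [set T | is_ssyt T & standard v w T].

End Tableaux.

(* Main.v *)
Require Import Defs.
From mathcomp Require Import all_boot all_fingroup.
From mathcomp Require Import zify.

(* Both orders are comparisons of counting functions: I <= J iff I has at least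
   as many elements below x as J, for every x. We show that a tableau T with
   v <= I_k <= w for all k has a defining chain v <= u_1 <= ... <= u_d <= w, by
   induction on n: delete the maximum n from v, w and the columns, and reinsert
   it into the chain obtained for n - 1. That the reduced columns still lie
   between the induced permutations, and that the insertion positions can be
   chosen weakly decreasing, rests on the following property of T_n: if
   t' <= i < t, then v_i is the largest of v_1, ..., v_i and w_(i+1) the largest
   of w_(i+1), ..., w_n. Once some defining chain exists, the extremal ones are
   built column by column from Deodhar's lemma: among the u >= s whose first k
   values form a given set, if any, there is a least one. The extremal chains
   then satisfy the bounds defining standardness. Conversely
   I_k = {u_k(1), ..., u_k(|I_k|)} and u_1 <= u_k <= u_d give v <= I_k <= w. *)

Set Implicit Arguments.
Unset Strict Implicit.
Unset Printing Implicit Defensive.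

(** * Counting functions of subsets, rank functions of permutations, Bruhat order *)

Section Counting.
Variable n : nat.
Implicit Types (I J : {set 'I_n}) (u v w : 'S_n) (i : 'I_n) (k x y : nat).

Definition cnt I x : nat := #|[set i in I | i < x]|.

Lemma cnt_homo I x y : x <= y -> cnt I x <= cnt I y.
Proof.
move=> lexy; apply/subset_leq_card/subsetP => i.
by rewrite !inE => /andP[-> /leq_trans ->].
Qed.

Lemma cnt_full I x : n <= x -> cnt I x = #|I|.
Proof.
move=> lenx; apply: eq_card => i; rewrite !inE.
by rewrite (leq_trans (ltn_ord i) lenx) andbT.
Qed.

Lemma cnt_le_card I x : cnt I x <= #|I|.
Proof. by rewrite -(@cnt_full I (maxn n x)) ?leq_maxl // cnt_homo ?leq_maxr. Qed.

Lemma cnt0 I : cnt I 0 = 0.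
Proof. by apply: eq_card0 => i; rewrite !inE andbF. Qed.

Lemma cntS I i : cnt I i.+1 = cnt I i + (i \in I).
Proof.
case: (boolP (i \in I)) => Ii.
  rewrite addn1 /cnt (cardsD1 i) inE Ii ltnSn add1n; congr _.+1.
  apply: eq_card => j; rewrite !inE -(inj_eq val_inj) /= ltnS.
  by case: (j \in I); rewrite ?andbF //= [in RHS]ltn_neqAle.
rewrite addn0; apply: eq_card => j; rewrite !inE.
case: (eqVneq j i) => [->|]; first by rewrite (negPf Ii).
by rewrite -(inj_eq val_inj) /= ltnS [in RHS]ltn_neqAle => ->.
Qed.

Lemma cntU1 I i x : i \notin I -> cnt (i |: I) x = cnt I x + (i < x).
Proof.
move=> Ii; case: (ltnP i x) => ix.
  rewrite addn1 /cnt (cardsD1 i) !inE eqxx ix /= add1n; congr _.+1.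
  apply: eq_card => j; rewrite !inE.
  by case: (eqVneq j i) => [->|] //=; rewrite (negPf Ii).
rewrite addn0; apply: eq_card => j; rewrite !inE.
by case: (eqVneq j i) => [->|] //=; rewrite (negPf Ii) ltnNge ix.
Qed.

Lemma cnt_add I x d : cnt I (x + d) <= cnt I x + d.
Proof.
elim: d => [|d IHd]; first by rewrite !addn0.
rewrite !addnS; case: (ltnP (x + d) n) => xd.
  have := cntS I (Ordinal xd) => /= ->.
  by case: (_ \in I); lia.
by move: IHd; rewrite (@cnt_full I (x + d)) // (@cnt_full I (x + d).+1); lia.
Qed.

Lemma cnt_lip I x y : x <= y -> cnt I y <= cnt I x + (y - x).
Proof. by move=> xy; have := cnt_add I x (y - x); rewrite subnKC. Qed.

(** In an increasing list the entries below [x] form a prefix. The conjunct [k < size s] excludes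
    the default value of [nth]. *)
Lemma count_sorted (s : seq nat) k x :
  sorted ltn s -> (k < count (fun a => a < x) s) = (k < size s) && (nth 0 s k < x).
Proof.
elim: s k => [|a s IHs] k //= Hs.
have {}IHs := IHs _ (path_sorted Hs).
have Hmin := order_path_min ltn_trans Hs.
case: (ltnP a x) => ax /=.
  by case: k => [|k]; rewrite add1n /= ?ltnS ?ax // IHs.
rewrite add0n; have /eqP-> : count (fun a => a < x) s == 0.
  rewrite -leqn0 leqNgt -has_count; apply/hasPn => b /(allP Hmin) /=; lia.
case: k => [|k] /=; first by lia.
apply/esym/negP => /andP[ks]; have /(allP Hmin) := mem_nth 0 ks; rewrite /=; lia.
Qed.

Lemma cnt_elements I k x :
  (k < cnt I x) = (k < #|I|) && (nth 0 (elements I) k < x).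
Proof.
rewrite -(size_elements I) -count_sorted ?elements_sorted //.
rewrite /elements count_map /cnt cardsE cardE -size_filter /enum_mem -filter_predI.
by congr (_ < size _); apply: eq_filter => i; rewrite !inE andbC.
Qed.

Lemma subset_leP I J : reflect (forall x, cnt J x <= cnt I x) (subset_le I J).
Proof.
apply: (iffP andP) => [[sJI /forallP leIJ] x|le_cnt].
  case E: (cnt J x) => [|k] //; have := cnt_elements J k x.
  rewrite E ltnSn => /esym/andP[kJ nJ].
  rewrite cnt_elements (leq_trans kJ sJI) /=.
  exact: leq_ltn_trans (leIJ (Ordinal kJ)) nJ.
split; first by have := le_cnt n; rewrite !cnt_full.
apply/forallP => k.
(* Taking [x] just above the [k]-th element of [J] turns the bound on counts into a bound on [k]-th
   elements. *)
have := cnt_elements J k (nth 0 (elements J) k).+1; rewrite ltn_ord ltnSn => /=.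
by move=> /leq_trans/(_ (le_cnt _)); rewrite cnt_elements ltnS => /andP[].
Qed.

Lemma subset_le_trans : transitive (@subset_le n).
Proof.
move=> J I K /subset_leP IJ /subset_leP JK; apply/subset_leP => x.
exact: leq_trans (JK x) (IJ x).
Qed.

Lemma cnt_inj I J : (forall x, cnt I x = cnt J x) -> I = J.
Proof. by move=> E; apply: subset_le_anti; apply/subset_leP => x; rewrite E. Qed.

(** The corner rank function of the permutation matrix of [u]; Bruhat order is its reversed
    pointwise order. *)
Definition rk u k x : nat := cnt (initial u k) x.

Lemma initial0 u : initial u 0 = set0.
Proof. by apply/setP => z; rewrite inE; apply/imsetP => -[i]; rewrite inE. Qed.

Lemma initialS u i : initial u i.+1 = u i |: initial u i.
Proof.
apply/setP => z; rewrite -(permKV u z) inE !mem_initial inE (inj_eq perm_inj).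
by rewrite -(inj_eq val_inj) /=; lia.
Qed.

Lemma initial_full u k : n <= k -> initial u k = setT.
Proof.
move=> nk; apply/setP => z; rewrite -(permKV u z) mem_initial inE.
exact: leq_trans (ltn_ord _) nk.
Qed.

Lemma card_initial u k : k <= n -> #|initial u k| = k.
Proof.
elim: k => [|k IHk] kn; first by rewrite initial0 cards0.
by rewrite (initialS u (Ordinal kn)) cardsU1 mem_initial /= ltnn IHk ?add1n // ltnW.
Qed.

Lemma rk0 u x : rk u 0 x = 0.
Proof. by apply/eqP; rewrite -leqn0 (leq_trans (cnt_le_card _ _)) // initial0 cards0. Qed.

Lemma rkS u i x : rk u i.+1 x = rk u i x + (u i < x).
Proof. by rewrite /rk initialS cntU1 // mem_initial ltnn. Qed.

Lemma rk_full u k x : n <= k -> rk u k x = minn x n.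
Proof.
move=> nk; rewrite /rk initial_full //; elim: x => [|x IHx].
  by rewrite cnt0 min0n.
case: (ltnP x n) => xn; last by rewrite cnt_full ?cardsT ?card_ord; lia.
by have := cntS setT (Ordinal xn); rewrite /= inE IHx => ->; lia.
Qed.

Lemma rk_le_pos u k x : k <= n -> rk u k x <= k.
Proof. by move=> kn; rewrite -{2}(card_initial u kn) cnt_le_card. Qed.

Lemma rk_top u k x : k <= n -> n <= x -> rk u k x = k.
Proof. by move=> kn nx; rewrite /rk cnt_full ?card_initial. Qed.

Lemma rk_add u k d x : rk u k x <= rk u (k + d) x <= rk u k x + d.
Proof.
elim: d => [|d IHd]; first by rewrite !addn0 leqnn.
rewrite addnS; case: (ltnP (k + d) n) => kd.
  by have := rkS u (Ordinal kd) x => /= ->; case: (_ < x); lia.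
by rewrite (@rk_full u (k + d).+1) ?(leqW kd) // (@rk_full u (k + d)) // in IHd *; lia.
Qed.

Lemma rk_homo u k l x : k <= l -> rk u k x <= rk u l x.
Proof. by move=> kl; case/andP: (rk_add u k (l - k) x); rewrite subnKC. Qed.

Lemma rk_lip u k l x : k <= l -> rk u l x <= rk u k x + (l - k).
Proof. by move=> kl; case/andP: (rk_add u k (l - k) x); rewrite subnKC. Qed.

Lemma bruhat_leP v w :
  reflect (forall k x, k <= n -> x <= n -> rk w k x <= rk v k x) (bruhat_le v w).
Proof.
apply: (iffP forallP) => [le_vw k x|le_rk k].
  case: k => [|k] kn _; first by rewrite !rk0.
  by have /subset_leP := le_vw (Ordinal kn); apply.
apply/subset_leP => x; case: (leqP x n) => xn; first exact: le_rk.
by rewrite !cnt_full ?card_initial // ltnW.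
Qed.

Lemma bruhat_le_rk v w k x : bruhat_le v w -> k <= n -> rk w k x <= rk v k x.
Proof.
move=> /bruhat_leP le_vw kn; case: (leqP x n) => xn; first exact: le_vw.
by rewrite !rk_top // ltnW.
Qed.

Lemma bruhat_le_refl : reflexive (@bruhat_le n).
Proof. by move=> v; apply/bruhat_leP. Qed.

Lemma bruhat_le_trans : transitive (@bruhat_le n).
Proof.
move=> v u w /bruhat_leP uv /bruhat_leP vw; apply/bruhat_leP => k x kn xn.
exact: leq_trans (vw k x kn xn) (uv k x kn xn).
Qed.

Lemma card_le_n I : #|I| <= n.
Proof. by rewrite -[leqRHS]card_ord max_card. Qed.

Lemma subset_le_permP I w :
  reflect (forall x, rk w #|I| x <= cnt I x) (subset_le_perm I w).
Proof. exact: subset_leP. Qed.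

Lemma perm_le_subsetP v I :
  reflect (forall x, cnt I x <= rk v #|I| x) (perm_le_subset v I).
Proof. exact: subset_leP. Qed.

Definition starts_with u I : bool := I == initial u #|I|.

Lemma starts_withP u I :
  reflect (forall x, cnt I x = rk u #|I| x) (starts_with u I).
Proof. by apply: (iffP eqP) => [E x|/cnt_inj //]; rewrite {1}E. Qed.

(** The longest element. Products apply the left factor first, so [w0 * u] reverses the positions of
    [u] and [u * w0] complements its values; each of the two operations reverses Bruhat order. *)
Definition w0 : 'S_n := perm (@rev_ord_inj n).

Lemma rk_mulw0l u k x : k <= n -> x <= n -> rk (w0 * u)%g k x + rk u (n - k) x = x.
Proof.
move=> + xn; elim: k => [|k IHk] kn; first by rewrite rk0 subn0 rk_full; lia.
have kn' : n - k.+1 < n by lia.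
have := rkS (w0 * u)%g (Ordinal kn) x; have := rkS u (Ordinal kn') x.
rewrite /= permM permE /=.
have -> : rev_ord (Ordinal kn) = Ordinal kn' by apply: val_inj.
have -> : (n - k.+1).+1 = n - k by lia.
by have := IHk (ltnW kn); lia.
Qed.

Lemma rk_mulw0r u k x : k <= n -> x <= n -> rk (u * w0)%g k x + rk u k (n - x) = k.
Proof.
move=> + xn; elim: k => [|k IHk] kn; first by rewrite !rk0.
have := rkS (u * w0)%g (Ordinal kn) x; have := rkS u (Ordinal kn) (n - x).
rewrite /= permM permE /=; have := IHk (ltnW kn).
by have := ltn_ord (u (Ordinal kn)); lia.
Qed.

Lemma w0K : (w0 * w0 = 1)%g.
Proof. by apply/permP => i; rewrite permM !permE rev_ordK. Qed.

Lemma bruhat_le_mulw0l v w : bruhat_le (w0 * v)%g (w0 * w)%g = bruhat_le w v.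
Proof.
suff H u t : bruhat_le u t -> bruhat_le (w0 * t)%g (w0 * u)%g.
  apply/idP/idP => [/H|]; last exact: H.
  by rewrite !mulgA w0K !mul1g.
move=> /bruhat_leP le_ut; apply/bruhat_leP => k x kn xn.
have := le_ut (n - k) x (leq_subr _ _) xn.
by have := rk_mulw0l u kn xn; have := rk_mulw0l t kn xn; lia.
Qed.

Lemma bruhat_le_mulw0r v w : bruhat_le (v * w0)%g (w * w0)%g = bruhat_le w v.
Proof.
suff H u t : bruhat_le u t -> bruhat_le (t * w0)%g (u * w0)%g.
  apply/idP/idP => [/H|]; last exact: H.
  by rewrite -!mulgA w0K !mulg1.
move=> /bruhat_leP le_ut; apply/bruhat_leP => k x kn xn.
have := le_ut k (n - x) kn (leq_subr _ _).
by have := rk_mulw0r u kn xn; have := rk_mulw0r t kn xn; lia.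
Qed.

Lemma rk_id k x : k <= n -> rk 1%g k x = minn k x.
Proof.
elim: k => [|k IHk] kn; first by rewrite rk0 min0n.
by have := rkS 1%g (Ordinal kn) x; rewrite /= perm1 IHk ?(ltnW kn) //= => ->; lia.
Qed.

Lemma cnt_le_x I x : cnt I x <= x.
Proof. by have := cnt_lip I (leq0n x); rewrite cnt0 subn0. Qed.

Lemma bruhat_le_id u : bruhat_le 1%g u.
Proof.
apply/bruhat_leP => k x kn xn.
by rewrite rk_id // leq_min rk_le_pos // cnt_le_x.
Qed.

Lemma bruhat_le_w0 u : bruhat_le u w0.
Proof.
have := bruhat_le_mulw0l (w0 * u)%g 1%g.
by rewrite mulgA w0K mul1g mulg1 bruhat_le_id.
Qed.

End Counting.

Section Deodhar.
Variable n : nat.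
Implicit Types (I J : {set 'I_n}) (u v w s t : 'S_n) (i : 'I_n) (k x y : nat).

(* Greedy lift of s into I: position k receives the least unused element of I
   that is at least s k. An element of I left over by the first k positions
   then witnesses that the count up to it cannot be increased. *)
Lemma exists_greedy s I j :
  (forall x, cnt I x <= rk s #|I| x) -> j <= #|I| ->
  exists2 u : 'S_n, (forall i, i < j -> u i \in I) &
    forall k, k <= j -> (forall x, rk u k x <= rk s k x) /\
      (forall z, z \in I -> z \notin initial u k -> rk u k z.+1 = rk s k z.+1).
Proof.
move=> le_I_s; elim: j => [|j IHj] jI.
  exists 1%g => // k; rewrite leqn0 => /eqP->.
  by split=> [x|z _ _]; rewrite !rk0.
have [u uI inv_u] := IHj (ltnW jI).
have jn : j < n := leq_trans jI (card_le_n I).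
pose oj := Ordinal jn.
have [le_us eq_us] := inv_u j (leqnn j).
have card_uj : #|initial u j| = j by rewrite card_initial // ltnW.
pose P (y : 'I_n) := [&& y \in I, y \notin initial u j & s oj <= y].
have [y0 Py0] : exists y : 'I_n, P y.
  apply/existsP; apply: contraT => /existsPn noP.
  have [z0 /setDP[z0I z0u]] : exists z, z \in I :\: initial u j.
    apply/set0Pn; rewrite -subset0; apply/negP => sub.
    have : #|I :\: initial u j| <= 0 by rewrite -(@cards0 'I_n) subset_leq_card.
    rewrite leqn0 cards_eq0 setD_eq0 => /subset_leq_card; rewrite card_uj; lia.
  pose Q (z : 'I_n) := (z \in I) && (z \notin initial u j).
  have Q0 : Q z0 by rewrite /Q z0I.
  case: (arg_maxnP (fun z : 'I_n => z : nat) Q0) => z /andP[zI zu] zmax.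
  have zs : z < s oj by have := noP z; rewrite /P zI zu /= -ltnNge.
  have E1 := eq_us z zI zu.
  have E2 := rkS s oj z.+1; rewrite /= in E2.
  have E3 := @rk_lip _ s j.+1 #|I| z.+1 jI.
  have E4 := le_I_s z.+1.
  have E5 : #|I| + rk u j z.+1 <= j + cnt I z.+1.
    have cntC (K : {set 'I_n}) x : cnt K x + #|[set i in K | x <= i]| = #|K|.
      rewrite -(cardsID [set i : 'I_n | i < x] K) /cnt; congr (_ + _).
        by apply: eq_card => i; rewrite !inE.
      by apply: eq_card => i; rewrite !inE -leqNgt andbC.
    have sub : [set i in I | z < i] \subset [set i in initial u j | z < i].
      apply/subsetP => i; rewrite !inE => /andP[iI zi]; rewrite zi andbT.
      by apply: contraT => iu; have := zmax i; rewrite /Q iI iu => /(_ isT) /=; rewrite leqNgt zi.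
    have := subset_leq_card sub; have := cntC I z.+1; have := cntC (initial u j) z.+1.
    by rewrite -/(rk u j z.+1) card_uj; lia.
  by move: E2; rewrite ltnS leqNgt zs; lia.
case: (arg_minnP (fun y : 'I_n => y : nat) Py0) => y /and3P[yI yu sy] ymin.
(* The transposition puts [y] at position [j]; neither swapped value occurs at an earlier
   position. *)
pose u' := (u * tperm (u oj) y)%g.
have u'lt i : i < j -> u' i = u i.
  move=> ij; rewrite permM tpermD //.
    by rewrite (inj_eq perm_inj) -(inj_eq val_inj) /=; lia.
  by apply: contraNneq yu => ->; rewrite mem_initial.
have u'j : u' oj = y by rewrite permM tpermL.
have init_u' k : k <= j -> initial u' k = initial u k.
  by move=> kj; apply: eq_in_imset => i; rewrite inE => ik; apply: u'lt; lia.
exists u' => [i|k].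
  rewrite ltnS leq_eqVlt => /predU1P[ij|ij]; last by rewrite u'lt // uI.
  by rewrite (_ : i = oj) ?u'j //; apply: val_inj.
rewrite leq_eqVlt ltnS => /predU1P[-> {k}|kj]; last first.
  by rewrite /rk init_u' //; apply: inv_u.
have rk_u' x : rk u' j.+1 x = rk u j x + (y < x).
  by have /= := rkS u' oj x; rewrite u'j /rk (init_u' j).
have rk_s x := rkS s oj x; rewrite /= in rk_s.
split=> [x|z zI].
  by rewrite rk_u' rk_s; have := le_us x; lia.
rewrite (initialS u' oj) u'j init_u' // inE negb_or inE => /andP[zy zu].
rewrite rk_u' rk_s eq_us //; congr (_ + _).
case: (leqP (s oj) z) => sz; last by lia.
have := ymin z; rewrite /P zI zu sz => /(_ isT).
by move: zy; rewrite -(inj_eq val_inj) /=; lia.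
Qed.

(** The greedy lift is optimal on the first [#|I|] positions, by induction on [x]: a competitor's
    rank gains on that of [u] only at a value [z] of [I] that the competitor has used and [u] has
    not, and there the rank of [u] equals that of [s], which bounds the rank of every [u'] above
    [s]. *)
Lemma exists_half_lift s I :
  (forall x, cnt I x <= rk s #|I| x) ->
  exists u, [/\ starts_with u I,
    forall k x, k <= #|I| -> rk u k x <= rk s k x &
    forall u', starts_with u' I -> bruhat_le s u' ->
      forall k x, k <= #|I| -> rk u' k x <= rk u k x].
Proof.
move=> le_I_s; have [u uI inv_u] := exists_greedy le_I_s (leqnn _).
have eqI : initial u #|I| = I.
  apply/eqP; rewrite eqEcard card_initial ?card_le_n // leqnn andbT.
  by apply/subsetP => _ /imsetP[i + ->]; rewrite inE; apply: uI.
exists u; split=> [|k x kI|u' /eqP u'I le_su' k x kI].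
- by rewrite /starts_with eqI.
- by case: (inv_u k kI) => ->.
case: (inv_u k kI) => le_us eq_us.
have kn : k <= n := leq_trans kI (card_le_n I).
elim: x => [|x IHx]; first by rewrite /rk !cnt0.
case: (ltnP x n) => xn; last by rewrite !rk_top // ltnW.
pose z := Ordinal xn; have := cntS (initial u' k) z; have := cntS (initial u k) z.
rewrite -/(rk u k _) -/(rk u' k _) -/(rk u k _) -/(rk u' k _) /=.
case: (boolP (z \in initial u' k)) => zu'; last by lia.
case: (boolP (z \in initial u k)) => zu; first by lia.
have zI : z \in I.
  by rewrite u'I; apply: subsetP zu'; apply/imsetS/subsetP => i; rewrite !inE; lia.
by move=> _ _; have /= -> := eq_us z zI zu; apply: bruhat_le_rk.
Qed.

Lemma initial_mulw0l u k : k <= n -> initial (w0 n * u)%g k = ~: initial u (n - k).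
Proof.
move=> kn; apply/setP => z; rewrite inE -(permKV u z) mem_initial.
set i := (u^-1)%g z; have -> : u i = (w0 n * u)%g (rev_ord i).
  by rewrite permM permE rev_ordK.
by rewrite mem_initial /=; have := ltn_ord i; lia.
Qed.

Lemma initial_mulw0r u k : initial (u * w0 n)%g k = w0 n @: initial u k.
Proof. by rewrite /initial -imset_comp; apply: eq_imset => i; rewrite permM. Qed.

Lemma starts_with_initial u t k :
  k <= n -> starts_with u (initial t k) = (initial t k == initial u k).
Proof. by move=> kn; rewrite /starts_with card_initial. Qed.

Lemma starts_with_mulw0l u t k : k <= n ->
  starts_with (w0 n * u)%g (initial (w0 n * t)%g (n - k)) = starts_with u (initial t k).
Proof.
move=> kn; rewrite !starts_with_initial ?leq_subr // !initial_mulw0l ?leq_subr //.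
by rewrite subKn // (inj_eq (@setC_inj _)).
Qed.

Lemma starts_with_mulw0r u t k : k <= n ->
  starts_with (u * w0 n)%g (initial (t * w0 n)%g k) = starts_with u (initial t k).
Proof.
move=> kn; rewrite !starts_with_initial // !initial_mulw0r.
by rewrite (inj_eq (imset_inj (@perm_inj _ _))).
Qed.

Lemma rk_conjw0 u k x : k <= n -> x <= n ->
  rk (w0 n * u * w0 n)%g k x + n = k + x + rk u (n - k) (n - x).
Proof.
move=> kn xn; have := rk_mulw0r (w0 n * u)%g kn xn.
by have := rk_mulw0l u kn (leq_subr x n); lia.
Qed.

(** Deodhar's lemma. Ranks at [l <= k] involve only the first [k] positions, and once [I] is fixed,
    ranks at [l >= k] involve only the remaining ones. The two halves are therefore optimized
    independently and glued. *)
Lemma exists_lower_lift s t I :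
  bruhat_le s t -> starts_with t I ->
  exists u, [/\ bruhat_le s u, starts_with u I &
    forall u', bruhat_le s u' -> starts_with u' I -> bruhat_le u u'].
Proof.
move=> le_st /eqP It; set k := #|I| in It; have kn : k <= n := card_le_n I.
have le_I_s x : cnt I x <= rk s k x by rewrite {1}It bruhat_le_rk.
have [u1 [u1I le_u1 min_u1]] := exists_half_lift le_I_s.
(* Conjugation by w0 keeps the Bruhat order and exchanges the first k
   positions with the last n - k. *)
pose c u := (w0 n * u * w0 n)%g.
have cK u : c (c u) = u by rewrite /c !mulgA w0K mul1g -mulgA w0K mulg1.
have c_le u v : bruhat_le (c u) (c v) = bruhat_le u v.
  by rewrite bruhat_le_mulw0r bruhat_le_mulw0l.
have nk : n - k <= n := leq_subr _ _.
(* The set of first [n - k] values of [c t] is the image under [w0] of the complement of [I]. *)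
pose I' := initial (c t) (n - k).
have cardI' : #|I'| = n - k by rewrite card_initial.
have c_start u : starts_with (c u) I' = starts_with u I.
  rewrite It /I' /c starts_with_mulw0r //.
  by rewrite starts_with_mulw0l.
have le_I'_cs x : cnt I' x <= rk (c s) #|I'| x.
  rewrite cardI' -/(rk (c t) (n - k) x).
  case: (leqP x n) => [xn|/ltnW nx]; last by rewrite !rk_top.
  have := le_I_s (n - x); rewrite {1}It -/(rk t k (n - x)) -/k.
  by have := rk_conjw0 t nk xn; have := rk_conjw0 s nk xn; rewrite /c subKn //; lia.
have [u2 [u2I le_u2 min_u2]] := exists_half_lift le_I'_cs.
rewrite cardI' in le_u2 min_u2.
rewrite -(cK u2) c_start in u2I.
(* Both [u1] and [c u2] send exactly the first [k] positions into [I], so gluing them is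
   injective. *)
pose f (i : 'I_n) := if i < k then u1 i else c u2 i.
have mem1 i : (u1 i \in I) = (i < k) by rewrite (eqP u1I) mem_initial.
have mem2 i : (c u2 i \in I) = (i < k) by rewrite (eqP u2I) mem_initial.
have f_inj : injective f.
  move=> i j; rewrite /f; case: ifP => ik; case: ifP => jk; try exact: perm_inj.
    by move=> E; have := mem1 i; rewrite E mem2 ik jk.
  by move=> E; have := mem2 i; rewrite E mem1 ik jk.
pose u := perm f_inj.
have rk_u1 l x : l <= k -> rk u l x = rk u1 l x.
  move=> lk; congr cnt; apply: eq_in_imset => i; rewrite inE => il.
  by rewrite permE /f (leq_trans il lk).
have uI : starts_with u I by apply/starts_withP => x; rewrite rk_u1 // -(starts_withP _ _ u1I).
(* At [d = 0] both ranks are [cnt I x]; from position [k] on the two permutations have the same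
   entries. *)
have rk_u2 d x : k + d <= n -> rk u (k + d) x = rk (c u2) (k + d) x.
  elim: d => [|d IHd]; first by rewrite addn0 -(starts_withP _ _ uI) -(starts_withP _ _ u2I).
  rewrite addnS => kd; have /= -> := rkS u (Ordinal kd) x.
  have /= -> := rkS (c u2) (Ordinal kd) x.
  rewrite IHd ?(ltnW kd) // [u _]permE /f /=.
  by rewrite (_ : (k + d < k) = false) //; lia.
have rk_u l x : l <= n -> x <= n -> ~~ (l <= k) ->
    rk u l x + n = l + x + rk u2 (n - l) (n - x).
  move=> ln xn lk; rewrite -(@subnKC k l) ?rk_u2 ?subnKC //; try lia.
  by rewrite -rk_conjw0.
exists u; split=> //.
  apply/bruhat_leP => l x ln xn.
  case: (boolP (l <= k)) => lk; first by rewrite rk_u1 ?le_u1.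
  have ln' : n - l <= n - k by lia.
  have := le_u2 (n - l) (n - x) ln'; have := rk_u l x ln xn lk.
  have := rk_conjw0 s (leq_subr l n) (leq_subr x n); rewrite !subKn // /c; lia.
move=> u' le_su' u'I; apply/bruhat_leP => l x ln xn.
case: (boolP (l <= k)) => lk; first by rewrite rk_u1 ?min_u1.
have ln' : n - l <= n - k by lia.
have := min_u2 (c u'); rewrite c_start c_le => /(_ u'I le_su' _ (n - x) ln').
have := rk_conjw0 u' (leq_subr l n) (leq_subr x n); have := rk_u l x ln xn lk.
by rewrite !subKn // /c; lia.
Qed.

(** Left multiplication by [w0] reverses Bruhat order and replaces the set of first [k] values by
    the complementary set of first [n - k] values, so a greatest lift becomes a least one. *)
Lemma exists_upper_lift s t I :
  bruhat_le t s -> starts_with t I ->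
  exists u, [/\ bruhat_le u s, starts_with u I &
    forall u', bruhat_le u' s -> starts_with u' I -> bruhat_le u' u].
Proof.
move=> le_ts tI; have It := eqP tI.
set k := #|I| in It; have kn : k <= n := card_le_n I.
pose I' := initial (w0 n * t)%g (n - k).
have w0_start u : starts_with (w0 n * u)%g I' = starts_with u I.
  by rewrite It starts_with_mulw0l.
have [|| u [le_su uI min_u]] := @exists_lower_lift (w0 n * s)%g (w0 n * t)%g I'.
- by rewrite bruhat_le_mulw0l.
- by rewrite w0_start.
have Eu : u = (w0 n * (w0 n * u))%g by rewrite mulgA w0K mul1g.
rewrite Eu in le_su uI min_u; rewrite w0_start in uI; rewrite bruhat_le_mulw0l in le_su.
exists (w0 n * u)%g; split=> // u' le_u's u'I.
by rewrite -bruhat_le_mulw0l; apply: min_u; rewrite ?w0_start ?bruhat_le_mulw0l.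
Qed.

End Deodhar.

(** * Least chains over a sequence of columns *)

Section Chains.
Variables (P C : Type) (leP : rel P) (mt : P -> C -> bool).
Hypothesis leP_trans : transitive leP.
Hypothesis least_lift : forall s t c, leP s t -> mt t c ->
  exists u, [/\ leP s u, mt u c & forall u', leP s u' -> mt u' c -> leP u u'].

(** The least lift is taken at each column in turn. It lies below the corresponding entry of any
    competing chain, so the rest of that chain remains a chain above it. The order is abstract
    because both Bruhat order and its reverse are used. *)
Lemma exists_least_chain s ts cs : path leP s ts -> all2 mt ts cs ->
  exists us, [/\ path leP s us, all2 mt us cs &
    forall us', path leP s us' -> all2 mt us' cs -> all2 leP us us'].
Proof.
elim: cs s ts => [|c cs IHcs] s [|t ts] //=; first by exists nil; split=> // -[].
move=> /andP[st ts_path] /andP[tc ts_cs].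
have [u [su uc min_u]] := least_lift st tc.
have ut := min_u t st tc.
have [us [us_path us_cs min_us]] :=
  IHcs u ts (path_le leP_trans ut ts_path) ts_cs.
exists (u :: us); split=> [||[|u' us'] //= /andP[su' us'_path] /andP[u'c us'_cs]].
- by rewrite /= su.
- by rewrite /= uc.
have uu' := min_u u' su' u'c; rewrite uu' /=; apply: min_us => //.
exact: path_le leP_trans _ _ _ uu' us'_path.
Qed.

End Chains.

Lemma all2_tnthP (A B : Type) (r : A -> B -> bool) d (s : d.-tuple A) (t : d.-tuple B) :
  reflect (forall k, r (tnth s k) (tnth t k)) (all2 r s t).
Proof.
elim: d s t => [|d IHd] s t.
  by rewrite (tuple0 s) (tuple0 t); apply: ReflectT => -[].
case/tupleP: s => a s; case/tupleP: t => b t /=.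
apply: (iffP andP) => [[rab /IHd rst] k|r_st].
  by case: (unliftP ord0 k) => [j|] ->; rewrite ?tnthS ?tnth0.
split; first by have := r_st ord0; rewrite !tnth0.
by apply/IHd => k; have := r_st (lift ord0 k); rewrite !tnthS.
Qed.

Lemma all2_rev (A B : Type) (r : A -> B -> bool) (s : seq A) (t : seq B) :
  size s = size t -> all2 r (rev s) (rev t) = all2 r s t.
Proof.
move=> Est; rewrite !all2E !size_rev Est eqxx /= -rev_zip // all_rev //.
Qed.

Lemma all2_swap (A B : Type) (r : A -> B -> bool) (s : seq A) (t : seq B) :
  all2 (fun b a => r a b) t s = all2 r s t.
Proof. by elim: s t => [|a s IHs] [|b t] //=; rewrite IHs. Qed.

(** * Deleting the maximum from a column and inserting it into a permutation *)

Section DeleteMax.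
Variable n : nat.
Implicit Types (I J : {set 'I_n.+1}) (p : 'I_n.+1) (u v : 'S_n) (k x y : nat).

Definition delmax I : {set 'I_n} := [set j | lift ord_max j \in I].

Lemma cnt_delmax I x : x <= n -> cnt (delmax I) x = cnt I x.
Proof.
elim: x => [|x IHx] xn; first by rewrite !cnt0.
have /= -> := cntS (delmax I) (Ordinal xn).
have := cntS I (lift ord_max (Ordinal xn)); rewrite lift_max /= => ->.
by rewrite IHx ?(ltnW xn) // inE.
Qed.

Lemma card_delmax I : #|delmax I| + (ord_max \in I) = #|I|.
Proof.
rewrite -(@cnt_full _ I n.+1) // -(@cnt_full _ (delmax I) n) // cnt_delmax //.
exact/esym/(cntS I ord_max).
Qed.

Lemma subset_le_delmax I J : subset_le I J -> subset_le (delmax I) (delmax J).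
Proof.
move=> /subset_leP le_IJ; apply/subset_leP => x.
case: (leqP x n) => [xn|/ltnW nx]; first by rewrite !cnt_delmax.
by rewrite !(cnt_full _ nx) -!(@cnt_full _ _ n) // !cnt_delmax.
Qed.

(** The inserted maximum is never below [x <= n]; it only uses up one of the first [k] positions
    when [p < k]. *)
Lemma rk_lift_perm p u k x : k <= n.+1 -> x <= n ->
  rk (lift_perm p ord_max u) k x = rk u (k - (p < k)) x.
Proof.
move=> + xn; elim: k => [|k IHk] kn; first by rewrite !rk0.
have := rkS (lift_perm p ord_max u) (Ordinal kn) x.
rewrite /= IHk ?(ltnW kn) // => ->.
case: (unliftP p (Ordinal kn)) => [j|] Ej.
  rewrite Ej lift_perm_lift lift_max.
  have Ek : k = bump p j by rewrite -[k]/(val (Ordinal kn)) Ej.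
  have Ek1 : k - (p < k) = j by rewrite Ek /bump; case: (leqP p j); lia.
  have -> : k.+1 - (p < k.+1) = j.+1.
    by rewrite Ek /bump; case: (leqP p j); lia.
  by rewrite Ek1 -rkS.
have <- : k = p :> nat by rewrite -Ej.
by rewrite Ej lift_perm_id ltnn ltnSn subn0 subn1 /= ltnNge xn addn0.
Qed.

Lemma bruhat_le_lift_perm (p q : 'I_n.+1) u v :
  q <= p -> bruhat_le u v ->
  bruhat_le (lift_perm p ord_max u) (lift_perm q ord_max v).
Proof.
move=> qp le_uv; apply/bruhat_leP => k x kn; rewrite leq_eqVlt ltnS.
case/predU1P => [->|xn]; first by rewrite !rk_top.
rewrite !rk_lift_perm //.
apply: leq_trans (bruhat_le_rk x le_uv _); last by have := ltn_ord p; lia.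
by apply: rk_homo; lia.
Qed.

Lemma starts_with_lift_perm p u I :
  (p < #|I|) = (ord_max \in I) -> starts_with u (delmax I) ->
  starts_with (lift_perm p ord_max u) I.
Proof.
move=> pI /starts_withP uI; have cardI := card_delmax I.
apply/starts_withP => x; case: (leqP x n) => xn; last first.
  by rewrite cnt_full ?rk_top ?card_le_n.
rewrite rk_lift_perm ?card_le_n // -cnt_delmax // uI pI.
by congr rk; lia.
Qed.

End DeleteMax.

(** * Positions of the two largest values, and the extremal property of pairs in T_n *)

Lemma lift_ord_max_max n : lift ord_max (ord_max : 'I_n.+1) = inord n :> 'I_n.+2.
Proof. by apply: val_inj; rewrite /= inordK // /bump ltnn. Qed.

(** The second largest value of [v] becomes the maximum of [induced v], so [s] and [s'] in
    [compatible] are determined by the positions of the maximum one level down. *)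
Lemma inv_inord n (v : 'S_n.+2) :
  (v^-1 (inord n) = lift (v^-1 ord_max) ((induced v)^-1 ord_max))%g.
Proof.
by apply: (canLR (permK v)); rewrite -{1}(induced_lift v) lift_perm_lift permKV lift_ord_max_max.
Qed.

Lemma induced_val n (v : 'S_n.+1) (i : 'I_n.+1) (j : 'I_n) :
  i = bump (v^-1 ord_max)%g j :> nat -> v i = induced v j :> nat.
Proof.
move=> ij; have -> : i = lift (v^-1 ord_max)%g j by apply: val_inj.
by rewrite -{1}(induced_lift v) lift_perm_lift lift_max.
Qed.

(** If the maximum of [induced w] were right of [i], the second largest value of [w] would lie right
    of [i.+1] in the decreasing run, forcing [w] to take its maximum at [i.+1], although that
    position is [t' <= i]. The increasing run of [v] gives the other bound in the same way. *)
Lemma compatible_induced n (v w : 'S_n.+2) i :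
  compatible v w -> (w^-1)%g ord_max <= i < (v^-1)%g ord_max ->
  ((induced w)^-1)%g ord_max <= i <= ((induced v)^-1)%g ord_max.
Proof.
rewrite /compatible /= => + /andP[t'i it]; rewrite !inv_inord /=.
set t := (v^-1 ord_max)%g in it *; set t' := (w^-1 ord_max)%g in t'i *.
set tb := ((induced v)^-1 ord_max)%g; set tb' := ((induced w)^-1 ord_max)%g.
case/predU1P => [E|/and5P[_ s't t's decr incr]]; first by move: t'i it; rewrite E; lia.
apply/andP; split.
  rewrite leqNgt; apply/negP => itb'.
  have sE : bump t' tb' = tb'.+1 by rewrite /bump; lia.
  have ltj : i.+1 < n.+2 by have := ltn_ord t; lia.
  have := forallP (forallP decr (Ordinal ltj)) (lift t' tb').
  rewrite /= sE in s't *; have -> : [&& t' <= i.+1, i.+1 < tb'.+1 & tb' < t] by lia.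
  rewrite /= -inv_inord permKV inordK // => lt_n_w.
  have : w (Ordinal ltj) = ord_max.
    by apply: val_inj => /=; have := ltn_ord (w (Ordinal ltj)); lia.
  by move/(canRL (permK w)) => /(congr1 val) /=; rewrite -/t'; lia.
rewrite leqNgt; apply/negP => tbi.
have sE : bump t tb = tb by rewrite /bump; lia.
have lti : i < n.+2 by have := ltn_ord t; lia.
have := forallP (forallP incr (lift t tb)) (Ordinal lti).
rewrite /= sE in t's *; have -> : [&& t' <= tb, tb < i & i <= t] by lia.
rewrite /= -inv_inord permKV inordK // => lt_n_v.
have : v (Ordinal lti) = ord_max by apply: val_inj => /=; have := ltn_ord (v (Ordinal lti)); lia.
by move/(canRL (permK v)) => /(congr1 val) /=; rewrite -/t; lia.
Qed.

(** Since [t' <= i < t], deleting the maximum leaves [v] unchanged up to [i] and shifts the entries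
    of [w] after [i] one place left. Either the relevant position now holds the maximum of the
    induced permutation, or the induction hypothesis applies, at [i] for [v] and at [i.-1] for
    [w]. *)
Lemma in_T_extremal m (v w : 'S_m.+1) (i : nat) :
  in_T_succ v w -> (w^-1)%g ord_max <= i < (v^-1)%g ord_max ->
  (forall j k : 'I_m.+1, j <= i -> k = i :> nat -> v j <= v k) /\
  (forall j k : 'I_m.+1, i < j -> k = i.+1 :> nat -> w j <= w k).
Proof.
elim: m v w i => [|m IHm] v w i; first by rewrite !ord1; lia.
move=> /andP[in_vw comp_vw] /andP[t'i it].
have /andP[tb'i itb] := compatible_induced comp_vw (introT andP (conj t'i it)).
set t := (v^-1 ord_max)%g in it *; set t' := (w^-1 ord_max)%g in t'i *.
set vb := induced v in in_vw itb *; set wb := induced w in in_vw tb'i *.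
have lti : i < m.+1 by have := ltn_ord t; lia.
pose oi := Ordinal lti.
have v_low (j : 'I_m.+2) : j <= i -> v j = vb (inord j) :> nat.
  by move=> ji; apply: induced_val; rewrite inordK /bump -/t; lia.
have w_high (j : 'I_m.+2) : i < j -> w j = wb (inord j.-1) :> nat.
  by move=> ij; have := ltn_ord j => jm; apply: induced_val; rewrite inordK /bump -/t'; lia.
split=> j k ji ki.
  rewrite v_low // v_low ?ki //.
  case: (eqVneq i ((vb^-1)%g ord_max : nat)) => [E|ne].
    suff -> : inord i = (vb^-1)%g ord_max by rewrite permKV /= -ltnS ltn_ord.
    by apply: val_inj; rewrite /= inordK.
  have itb' : (wb^-1)%g ord_max <= i < (vb^-1)%g ord_max by lia.
  by have [H _] := IHm _ _ _ in_vw itb'; apply: H; rewrite inordK //; lia.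
have jm := ltn_ord j.
rewrite w_high // w_high ?ki //=.
case: (eqVneq i ((wb^-1)%g ord_max : nat)) => [E|ne].
  suff -> : inord i = (wb^-1)%g ord_max by rewrite permKV /= -ltnS ltn_ord.
  by apply: val_inj; rewrite /= inordK.
have itb' : (wb^-1)%g ord_max <= i.-1 < (vb^-1)%g ord_max by lia.
have [_ H] := IHm _ _ _ in_vw itb'; apply: H; rewrite inordK //; lia.
Qed.

(** * Columns between [v] and [w] after deletion of the maximum *)

Lemma rk_induced n (v : 'S_n.+1) k x : k <= n.+1 -> x <= n ->
  rk v k x = rk (induced v) (k - ((v^-1)%g ord_max < k)) x.
Proof. by move=> kn xn; rewrite -{1}(induced_lift v) rk_lift_perm. Qed.

Lemma rk_initial_lt n (v : 'S_n) k x : k <= n ->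
  (forall j : 'I_n, j < k -> v j < x) -> rk v k x = k.
Proof.
move=> kn lt_v; rewrite -[RHS](card_initial v kn).
by apply: eq_card => z; rewrite inE andb_idr // => /imsetP[j + ->]; rewrite inE; apply: lt_v.
Qed.

Lemma rk_final_lt n (w : 'S_n) k x : k <= n -> x <= n ->
  (forall j : 'I_n, k <= j -> w j < x) -> rk w k x + (n - k) = x.
Proof.
move=> + xn; move En: (n - k) => d; elim: d k En => [|d IHd] k En kn lt_w.
  by rewrite rk_full; lia.
have kn' : k < n by lia.
have := rkS w (Ordinal kn') x; rewrite lt_w //= => E.
have := IHd k.+1; rewrite E => H; rewrite addn1 addSnnS in H.
by apply: H => [||j kj]; try lia; apply: lt_w; apply: ltnW.
Qed.

(** Compare counts at [m.+1], where exactly the maximum is left out. *)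
Lemma in_T_window m (v w : 'S_m.+2) (I : {set 'I_m.+2}) :
  perm_le_subset v I -> subset_le_perm I w ->
  ((v^-1)%g ord_max < #|I| -> ord_max \in I) /\
  (ord_max \in I -> (w^-1)%g ord_max < #|I|).
Proof.
move=> /perm_le_subsetP le_vI /subset_le_permP le_Iw.
have cI : cnt I m.+1 + (ord_max \in I) = #|I| by rewrite -cnt_delmax // cnt_full ?card_delmax.
have cn := card_le_n I.
have tn := ltn_ord (v^-1 ord_max)%g; have t'n := ltn_ord (w^-1 ord_max)%g.
have := le_vI m.+1; have := le_Iw m.+1; rewrite (rk_induced v) // (rk_induced w) // !rk_top; lia.
Qed.

Lemma between_delmax m (v w : 'S_m.+2) (I : {set 'I_m.+2}) :
  @in_T_succ m.+1 v w -> perm_le_subset v I -> subset_le_perm I w ->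
  perm_le_subset (induced v) (delmax I) /\ subset_le_perm (delmax I) (induced w).
Proof.
move=> in_vw vI Iw; have [t_max max_t'] := in_T_window vI Iw.
have extr i := @in_T_extremal _ _ _ i in_vw.
move/perm_le_subsetP: vI => vI; move/subset_le_permP: Iw => Iw.
have cardI := card_delmax I; have cardn := card_le_n I.
have cI : cnt I m.+1 = #|delmax I| by rewrite -cnt_delmax // cnt_full.
set t := (v^-1 ord_max)%g in t_max extr *; set t' := (w^-1 ord_max)%g in max_t' extr *.
split.
  apply/perm_le_subsetP => x.
  case: (leqP x m.+1) => xm; last by rewrite cnt_full ?rk_top ?card_le_n // ltnW.
  rewrite cnt_delmax //; have := vI x; rewrite rk_induced // -/t.
  case: (boolP (t < #|I|)) => tI.
    by move/t_max: tI cardI => -> <-; rewrite addn1 subn1.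
  rewrite subn0; case: (boolP (ord_max \in I)) cardI => maxI cardI; last first.
    by rewrite -cardI addn0.
  (* Here [t' < #|I| <= t], and the prefix of [v] shrinks by its last entry. If that entry is below
     [x], so are all earlier ones, being no larger, and the shorter prefix already has full rank. *)
  have t'I := max_t' maxI.
  have ltI : #|delmax I| < m.+2 by lia.
  have [|low _] := extr #|delmax I|; first by lia.
  have E1 : rk (induced v) #|delmax I| x = rk v #|delmax I| x.
    by rewrite (rk_induced v) ?(ltnW ltI) // -/t; congr (rk _ _ _); lia.
  have := vI x; rewrite E1 -cardI addn1 (rkS v (Ordinal ltI)) /=.
  case: ltnP => vx; last by rewrite addn0.
  rewrite (@rk_initial_lt _ v #|delmax I|) ?(ltnW ltI) //.
    by move=> _ _; rewrite -cI cnt_homo.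
  by move=> j jI; apply: leq_ltn_trans vx; apply: low => //; apply: ltnW.
apply/subset_le_permP => x.
case: (leqP x m.+1) => xm; last by rewrite cnt_full ?rk_top ?card_le_n // ltnW.
rewrite cnt_delmax //; have := Iw x; rewrite rk_induced // -/t'.
case: (boolP (ord_max \in I)) cardI => maxI cardI.
  by rewrite (max_t' maxI) -{1}cardI addn1 subn1.
rewrite addn0 in cardI.
case: (boolP (t' < #|I|)) => t'I; last by rewrite subn0 cardI.
(* Here [t' < #|I| <= t], and the prefix of [w] grows by one entry. If that entry is below [x], so
   are all later ones, which fixes [rk w #|I| x]; as [I] omits the maximum, at most [m.+1 - x] of
   its elements are at least [x], which leaves room for the extra one. *)
have tI : #|I| <= t by rewrite leqNgt; apply: contra maxI.
have ltI : #|I| < m.+2 by apply: leq_ltn_trans tI _.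
have [|_ high] := extr #|I|.-1; first by lia.
have E1 : rk (induced w) #|I| x = rk w #|I|.+1 x.
  by rewrite (rk_induced w) // -/t'; congr (rk _ _ _); lia.
rewrite cardI E1 (rkS w (Ordinal ltI)) /= => _.
have := Iw x; case: ltnP => wx; last by rewrite addn0.
have := @rk_final_lt _ w #|I| x.
have -> // : x <= m.+2 by apply: ltnW.
rewrite (ltnW ltI) => /(_ isT isT) H.
have {}H : rk w #|I| x + (m.+2 - #|I|) = x.
  apply: H => j Ij; apply: leq_ltn_trans wx.
  by apply: high; rewrite /= prednK // (leq_ltn_trans _ t'I).
have := cnt_lip I xm; rewrite cI cardI; set c := #|I| in H *; lia.
Qed.

(* Raising the insertion position of the maximum moves a permutation down, so
   the maximum is inserted into the k-th link at the leftmost position reached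
   so far: p, or #|I_l|.-1 for some l <= k with ord_max in I_l. *)
Lemma lift_chain n (w : 'S_n.+1) (T : seq {set 'I_n.+1}) us (u0 : 'S_n) (p : 'I_n.+1) :
  path (@bruhat_le n) u0 us -> all2 (@starts_with n) us (map (@delmax _) T) ->
  bruhat_le (last u0 us) (induced w) -> (w^-1)%g ord_max <= p ->
  sorted (@subset_le n.+1) T ->
  all (fun I : {set 'I_n.+1} => ((p < #|I|) ==> (ord_max \in I)) &&
                ((ord_max \in I) ==> ((w^-1)%g ord_max < #|I|))) T ->
  exists us', [/\ path (@bruhat_le n.+1) (lift_perm p ord_max u0) us',
    all2 (@starts_with n.+1) us' T &
    bruhat_le (last (lift_perm p ord_max u0) us') w].
Proof.
elim: T us u0 p => [|I T IHT] [|u us] u0 p //=.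
  move=> _ _ le_u0 t'p _ _; exists nil; split=> //=.
  by rewrite -(induced_lift w); apply: bruhat_le_lift_perm.
move=> /andP[u0u us_path] /andP[uI us_T] le_w t'p IT /andP[/andP[/implyP pI /implyP It']].
move=> /allP T_ok.
have [q [qp t'q qI q_T]] : exists q : 'I_n.+1, [/\ q <= p, (w^-1)%g ord_max <= q,
    (q < #|I|) = (ord_max \in I) & forall J, J \in T -> q < #|J| -> ord_max \in J].
  case: (boolP (ord_max \in I)) => maxI; last first.
    exists p; split=> // [|J /T_ok /andP[/implyP //]].
    by apply/negbTE; apply: contra maxI.
  have lt_I := It' maxI; have cn := card_le_n I.
  have qn : minn p #|I|.-1 < n.+1 by have := ltn_ord p; lia.
  exists (Ordinal qn); rewrite /=; split; [lia..|move=> J JT /= qJ].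
  have /andP[/implyP pJ _] := T_ok J JT.
  (* If [q < #|J| <= p], then [#|I|.-1 < #|J| <= #|I|], so the sizes agree; comparing counts below
     the maximum then puts it in [J] because it is in [I]. *)
  case: (ltnP p #|J|) => [/pJ //|Jp].
  have /allP/(_ J JT) := order_path_min (@subset_le_trans n.+1) IT.
  move=> /subset_leP/(_ n.+1); rewrite !cnt_full // => JI.
  have IJ : #|I| = #|J|.
    apply/eqP; rewrite eqn_leq JI andbT -(prednK (leq_ltn_trans (leq0n _) lt_I)).
    by move: qJ; rewrite gtn_min ltnNge Jp.
  have /allP/(_ J JT)/subset_leP/(_ n) := order_path_min (@subset_le_trans n.+1) IT.
  have := card_delmax I; have := card_delmax J; rewrite maxI IJ.
  rewrite -!(@cnt_full _ (delmax _) n) // !cnt_delmax //.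
  by case: (_ \in J) => //=; rewrite addn0 addn1 => <- <-; rewrite ltnn.
have [||us' [us'_path us'_T us'_w]] := IHT us u q us_path us_T le_w t'q.
- exact: path_sorted IT.
- apply/allP => J JT; have /andP[_ ->] := T_ok J JT.
  by rewrite andbT; apply/implyP; apply: q_T.
exists (lift_perm q ord_max u :: us'); split=> //=.
  by rewrite us'_path bruhat_le_lift_perm.
by rewrite us'_T starts_with_lift_perm.
Qed.

(** Columns range over all subsets, as deleting the maximum can make a proper non-empty column empty
    or full. *)
Lemma exists_chain_between m (v w : 'S_m.+1) (T : seq {set 'I_m.+1}) :
  in_T_succ v w -> sorted (@subset_le m.+1) T ->
  all (fun I : {set 'I_m.+1} => perm_le_subset v I && subset_le_perm I w) T ->
  exists us, [/\ path (@bruhat_le m.+1) v us, all2 (@starts_with m.+1) us T &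
    bruhat_le (last v us) w].
Proof.
elim: m v w T => [|m IHm] v w T.
  move=> /andP[/eqP-> /eqP->] _ T_ok; exists (nseq (size T) 1%g).
  elim: T T_ok => [|I T IHT] /=; first by rewrite bruhat_le_refl.
  move=> /andP[/andP[/perm_le_subsetP le1I /subset_le_permP leI1] /IHT[-> -> ->]].
  rewrite bruhat_le_refl; split=> //; rewrite andbT; apply/starts_withP => x.
  by apply/eqP; rewrite eqn_leq le1I leI1.
move=> in_vw T_sorted /allP T_ok; have /= /andP[in_vw' comp] := in_vw.
have T_ok' I : I \in T -> perm_le_subset v I /\ subset_le_perm I w.
  by move=> /T_ok/andP.
have [||us [us_path us_T us_w]] := IHm _ _ (map (@delmax _) T) in_vw'.
- by apply: homo_sorted T_sorted => I J; apply: subset_le_delmax.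
- apply/allP => _ /mapP[I /T_ok'[vI Iw] ->]; apply/andP.
  exact: between_delmax in_vw vI Iw.
have t't : (w^-1)%g ord_max <= (v^-1)%g ord_max.
  by move: comp; rewrite /compatible /= => /orP[/eqP-> //|/and5P[/ltnW]].
(* The insertion starts from the position of the maximum in [v]. *)
rewrite -[v]induced_lift; apply: lift_chain us_path us_T us_w t't T_sorted _.
apply/allP => I /T_ok'[vI Iw]; have [t_max max_t'] := in_T_window vI Iw.
by apply/andP; split; apply/implyP.
Qed.

(** * Extremal defining chains and standardness *)

Lemma defining_chainE n d (T : d.-tuple {set 'I_n}) (u : d.-tuple 'S_n) :
  defining_chain T u = sorted (@bruhat_le n) u && all2 (@starts_with n) u T.
Proof.
congr (_ && _); apply/forallP/all2_tnthP => H k; exact: H.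
Qed.

Section DefiningChains.
Variables n d : nat.
Implicit Types (T : d.-tuple {set 'I_n}) (u : d.-tuple 'S_n) (v w : 'S_n).

(** The identity is least in Bruhat order, so it serves as a starting point that imposes no
    constraint. *)
Lemma path_bruhat_le_id (us : seq 'S_n) :
  path (@bruhat_le n) 1%g us = sorted (@bruhat_le n) us.
Proof. by case: us => //= u us; rewrite bruhat_le_id. Qed.

Lemma path_w0_bruhat_ge (us : seq 'S_n) :
  path (fun a b => bruhat_le b a) (w0 n) us = sorted (fun a b => bruhat_le b a) us.
Proof. by case: us => //= u us; rewrite bruhat_le_w0. Qed.

Lemma exists_min_defining_chain T u0 :
  defining_chain T u0 -> exists u, min_defining_chain T u.
Proof.
rewrite defining_chainE -path_bruhat_le_id => /andP[u0_path u0T].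
have [us [us_path usT min_us]] :=
  exists_least_chain (@bruhat_le_trans n) (@exists_lower_lift n) u0_path u0T.
have sz : size us == d by move: usT; rewrite all2E size_tuple => /andP[].
exists (Tuple sz); apply/andP; split.
  by rewrite defining_chainE -path_bruhat_le_id us_path.
apply/forallP => u'; apply/implyP; rewrite defining_chainE -path_bruhat_le_id.
move=> /andP[u'_path u'T]; apply/forallP.
exact/(all2_tnthP _ (Tuple sz))/min_us.
Qed.

(** Read backwards, a greatest chain is a least chain for the reverse order, starting from [w0]. *)
Lemma exists_max_defining_chain T u0 :
  defining_chain T u0 -> exists u, max_defining_chain T u.
Proof.
pose ge (a b : 'S_n) := bruhat_le b a.
have ge_trans : transitive ge by move=> b a c ab bc; apply: bruhat_le_trans bc ab.
have chainE u : defining_chain T u =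
    path ge (w0 n) (rev u) && all2 (@starts_with n) (rev u) (rev T).
  by rewrite defining_chainE path_w0_bruhat_ge rev_sorted all2_rev ?size_tuple.
rewrite chainE => /andP[u0_path u0T].
have lift_ge s t I : ge s t -> starts_with t I -> exists u : 'S_n,
    [/\ ge s u, starts_with u I & forall u' : 'S_n, ge s u' -> starts_with u' I -> ge u u'].
  exact: exists_upper_lift.
have [us [us_path usT max_us]] := exists_least_chain ge_trans lift_ge u0_path u0T.
have sz : size (rev us) == d.
  by move: usT; rewrite all2E !size_rev size_tuple => /andP[].
exists (Tuple sz); apply/andP; split; first by rewrite chainE /= revK us_path.
apply/forallP => u'; apply/implyP; rewrite chainE => /andP[u'_path u'T].
have : all2 ge (rev (rev us)) (rev u') by rewrite revK max_us.
rewrite all2_rev; last by rewrite size_tuple (eqP sz).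
by rewrite all2_swap => /(all2_tnthP _ u' (Tuple sz)) le_u'; apply/forallP.
Qed.

Lemma sorted_bruhat_le_tnth u (i j : 'I_d) :
  sorted (@bruhat_le n) u -> i <= j -> bruhat_le (tnth u i) (tnth u j).
Proof.
move=> u_sorted ij; rewrite !(tnth_nth 1%g).
by apply: (sorted_leq_nth (@bruhat_le_trans n) (@bruhat_le_refl n)); rewrite ?inE ?size_tuple.
Qed.

Lemma perm_le_subset_bruhat v (u : 'S_n) (I : {set 'I_n}) :
  bruhat_le v u -> I = initial u #|I| -> perm_le_subset v I.
Proof.
by move=> vu E; apply/perm_le_subsetP => x; rewrite {1}E bruhat_le_rk ?card_le_n.
Qed.

Lemma subset_le_perm_bruhat (u : 'S_n) w (I : {set 'I_n}) :
  bruhat_le u w -> I = initial u #|I| -> subset_le_perm I w.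
Proof.
by move=> uw E; apply/subset_le_permP => x; rewrite {2}E bruhat_le_rk ?card_le_n.
Qed.

End DefiningChains.

Lemma standard_between n d (v w : 'S_n) (T : d.-tuple {set 'I_n}) :
  standard v w T -> all (fun I => perm_le_subset v I && subset_le_perm I w) T.
Proof.
case: d T => [|d] T; first by rewrite (tuple0 T).
move=> /andP[/existsP[u1 /andP[/andP[/andP[s1 /forallP c1] _] le_w]]].
move=> /existsP[u2 /andP[/andP[/andP[s2 /forallP c2] _] le_v]].
apply/all_tnthP => k; apply/andP; split.
  apply: perm_le_subset_bruhat (eqP (c2 k)); apply: bruhat_le_trans le_v _.
  rewrite (_ : head _ _ = tnth u2 ord0); first exact: sorted_bruhat_le_tnth.
  by rewrite (tnth_nth 1%g) nth0.
apply: subset_le_perm_bruhat (eqP (c1 k)); apply: bruhat_le_trans _ le_w.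
rewrite (_ : last _ _ = tnth u1 ord_max).
  by apply: sorted_bruhat_le_tnth => //; rewrite -ltnS.
by rewrite (tnth_nth 1%g) -nth_last size_tuple.
Qed.

(** The given chain lies between the extremal ones: the last minimal entry is below its last entry,
    hence below [w], and the first maximal entry is above its first entry, hence above [v]. *)
Lemma standard_of_chain n d (v w : 'S_n) (T : d.+1.-tuple {set 'I_n}) us :
  path (@bruhat_le n) v us -> all2 (@starts_with n) us T -> bruhat_le (last v us) w ->
  standard v w T.
Proof.
move=> us_path usT us_w.
have sz : size us == d.+1 by move: usT; rewrite all2E size_tuple => /andP[].
pose u0 := Tuple sz.
have chain_u0 : defining_chain T u0.
  by rewrite defining_chainE usT andbT (path_sorted us_path).
(* The default [x] is arbitrary because [last] is taken with [1] in [standard] and with [v] in the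
   bound on the path. *)
have last_u0 (x : 'S_n) (u : d.+1.-tuple 'S_n) : last x u = tnth u ord_max.
  by rewrite (last_nth 1%g) size_tuple (tnth_nth 1%g); case: u => -[].
have head_u (u : d.+1.-tuple 'S_n) : head 1%g u = tnth u ord0.
  by rewrite (tnth_nth 1%g) nth0.
have [u1 min_u1] := exists_min_defining_chain chain_u0.
have [u2 max_u2] := exists_max_defining_chain chain_u0.
apply/andP; split; apply/existsP; [exists u1|exists u2].
  rewrite min_u1 last_u0 /=; case/andP: min_u1 => _ /forallP/(_ u0).
  rewrite chain_u0 => /forallP/(_ ord_max) /bruhat_le_trans; apply.
  by rewrite -(last_u0 v).
rewrite max_u2 head_u /=; case/andP: max_u2 => _ /forallP/(_ u0).
rewrite chain_u0 => /forallP/(_ ord0); apply: bruhat_le_trans.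
by rewrite -head_u /=; case: us us_path {usT us_w u0 chain_u0} sz => //= u us /andP[].
Qed.

Theorem theorem3p12 (n d : nat) (hn : 1 <= n) (hd : 1 <= d) (v w : 'S_n)
    (hvw : in_T v w) :
  #|standard_tableaux d v w| = #|SSYT d v w|.
Proof.
case: n hn v w hvw => // m _ v w in_vw; case: d hd => // d _.
apply: eq_card => T; rewrite !inE; case: (boolP (is_ssyt T)) => //= /andP[_ T_sorted].
apply/idP/idP => [/standard_between //|T_ok].
have [us [us_path usT us_w]] := exists_chain_between in_vw T_sorted T_ok.
exact: standard_of_chain us_path usT us_w.
Qed.
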